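(* Let $X\subseteq\omega$ be a BK-space and let $t\in[0,1]$. Suppose that (i) $C_t$ exists in $X$, that is, $C_t\in\mathcal{L}(X)$, and (ii) the set $\{n\in\mathbb{N}_0 : z_t^{[n]}\in X'\setminus\{0\}\}$ contains at least two elements or the space $X$ contains $c_{00}$. Then $C_t$ is not supercyclic in $X$.
   Context: $\mathbb{N}_0=\{0,1,2,\dots\}$ and $\omega=\mathbb{C}^{\mathbb{N}_0}$ with the coordinatewise convergence topology; $c_{00}\subseteq\omega$ is the subspace of sequences with only finitely many non-zero coordinates. A BK-space is a linear subspace $X$ of $\omega$ equipped with a complete norm such that the inclusion $X\subseteq\omega$ is continuous; $X'$ is its topological dual. For $t\in[0,1]$ the generalized Cesàro operator on $\omega$ is $$C_tx=\Big(\frac{t^nx_0+t^{n-1}x_1+\dots+x_n}{n+1}\Big)_{n\in\mathbb{N}_0},$$ with the convention $t^0=1$ (also for $t=0$). ''$C_t$ exists in $X$'' means $C_t(X)\subseteq X$ (then automatically the restriction, again denoted $C_t$, is continuous on the BK-space $X$). For $r\in\mathbb{N}_0$ let $f_r(x)=x_r$ for $x\in\omega$, and for $n\in\mathbb{N}_0$ let $$z_t^{[n]}:=\sum_{i=0}^n(-1)^i\binom{n}{i}t^if_{n-i},$$ regarded, by restriction, as a linear functional on $X$. An operator $T\in\mathcal{L}(X)$ is supercyclic if there is $x\in X$ such that $\{\lambda T^nx : \lambda\in\mathbb{C},\ n\in\mathbb{N}_0\}$ is dense in $X$. *)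

(* Defs.v *)
From HB Require Import structures.
From mathcomp Require Import all_boot all_order all_algebra.
From mathcomp Require Import all_classical all_reals all_analysis.
From mathcomp Require Import complex.

Set Implicit Arguments.
Unset Strict Implicit.
Unset Printing Implicit Defensive.

Import Order.TTheory GRing.Theory Num.Theory.
Import numFieldNormedType.Exports.

Local Open Scope classical_set_scope.
Local Open Scope ring_scope.
Local Open Scope complex_scope.

(* R[i]^o is R[i] with the normed topology that it carries as a module over
   itself; {ptws nat -> _} has the product topology. *)
Definition omega (R : realType) : Type := {ptws nat -> R[i]^o}.
HB.instance Definition _ (R : realType) := Topological.on (omega R).
HB.instance Definition _ (R : realType) :=
  GRing.Lmodule.copy (omega R) (nat -> R[i]).

HB.mixin Record isBKSpace (R : realType) (S : pred (omega R)) (X : Type)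
    & @GRing.SubLmodule R[i] (omega R) S X & CompleteNormedModule R[i] X := {
  val_continuous : continuous (val : X -> omega R)
}.

(* X is the linear subspace {x | S x} of omega R with inclusion val, as a
   subtype. The norm of X is tied to omega R only through val_continuous. *)
#[short(type="bkSpaceType")]
HB.structure Definition BKSpace (R : realType) (S : pred (omega R)) :=
  { X of @GRing.SubLmodule R[i] (omega R) S X & CompleteNormedModule R[i] X
       & isBKSpace R S X }.

Definition c00 (R : realType) : set (omega R) :=
  [set x | finite_set [set n | x n != 0]].
Arguments c00 {R}.

Definition gen_cesaro (R : realType) (t : R) (x : omega R) : omega R :=
  fun n => (\sum_(k < n.+1) t%:C ^+ (n - k) * x k) / n.+1%:R.

Definition zfun (R : realType) (t : R) (n : nat) (x : omega R) : R[i]^o :=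
  \sum_(i < n.+1) (-1) ^+ i * 'C(n, i)%:R * t%:C ^+ i * x (n - i)%N.

Definition top_dual (K : numFieldType) (V : normedModType K) : set (V -> K^o) :=
  [set f | linear f /\ continuous f].
Arguments top_dual {K} V.

(* The restriction to a BK-space of a continuous linear map of omega is
   automatically continuous (closed graph theorem), so that continuity is not
   asked for. *)
Definition exists_in (R : realType) (S : pred (omega R))
  (T : omega R -> omega R) : Prop := forall x, x \in S -> T x \in S.

Definition restr_op (R : realType) (S : pred (omega R)) (X : bkSpaceType S)
    (T : omega R -> omega R) (hT : exists_in S T) (x : X) : X :=
  Sub (T (val x)) (hT (val x) (valP x)).
Arguments restr_op {R S} X {T} hT x.

Definition supercyclic (K : numFieldType) (V : normedModType K)
    (T : V -> V) : Prop :=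
  exists x : V, dense [set l *: iter n T x | l in [set: K] & n in [set: nat]].

(* Main.v *)
(* The functional z_t^[n] is an eigenvector of the adjoint of C_t for the
   eigenvalue 1/(n+1). Two eigenvectors of the adjoint with distinct eigenvalues
   exclude supercyclicity: one is bounded by a multiple of the other along the
   projective orbit of a supercyclic vector, hence on the whole space, although
   they are linearly independent. Every z_t^[n] is
   continuous on a BK-space, and it is nonzero when the space contains c00, so
   that z_t^[0] and z_t^[1] can be used in that case. *)
Require Import Defs.
From mathcomp Require Import all_boot all_order all_algebra.
From mathcomp Require Import all_classical all_reals all_analysis.
From mathcomp Require Import complex.
From mathcomp Require Import ring.
Import Order.TTheory GRing.Theory Num.Theory.
Import numFieldNormedType.Exports.
Local Open Scope classical_set_scope.
Local Open Scope ring_scope.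

Lemma dense_continuous_eq0 (K : numFieldType) (V : normedModType K)
    (D : set V) (h : V -> K^o) :
  dense D -> continuous h -> (forall v, D v -> h v = 0) -> forall v, h v = 0.
Proof.
move=> dD ch hD v; apply/eqP/negPn/negP => /eqP hv.
have oU : open (h @^-1` (~` [set 0])).
  apply: open_comp; first by move=> ? _; exact: ch.
  apply: closed_openC; apply: accessible_closed_set1.
  by apply: hausdorff_accessible; exact: norm_hausdorff.
have [w [/= hw Dw]] := dD _ (ex_intro _ v hv) oU.
exact: hw (hD w Dw).
Qed.

(* |g| <= c |f| along the projective orbit of x, hence everywhere by density;
   this fails at u = T y - a y, where f vanishes and g does not. *)
Lemma not_supercyclic_of_eigenfunctionals (K : numFieldType)
    (V : normedModType K) (T : V -> V) (a b : K) (f g : V -> K^o) :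
  top_dual V f -> top_dual V g -> f <> cst 0 -> g <> cst 0 ->
  (forall x, f (T x) = a * f x) -> (forall x, g (T x) = b * g x) ->
  a != b -> `|b| <= `|a| -> ~ supercyclic T.
Proof.
move=> [lf cf] [lg cg] f0 g0 fT gT ab leba [x dx].
have iterE (h : V -> K^o) c k : (forall y, h (T y) = c * h y) ->
    h (iter k T x) = c ^+ k * h x.
  by move=> hT; elim: k => [|k IH]; rewrite ?expr0 ?mul1r //= hT IH exprS mulrA.
have scale (h : V -> K^o) l y : linear h -> h (l *: y) = l * h y.
  move=> lh; have h0 : h 0 = 0.
    have := lh 1 0 0; rewrite !scale1r addr0 => /esym/eqP.
    by rewrite -subr_eq0 addrK => /eqP.
  by have := lh l y 0; rewrite h0 !addr0.
have fx : f x != 0.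
  apply/eqP => fx; apply: f0; apply/funext => v /=.
  apply: (dense_continuous_eq0 _ _ _ _ dx cf) => _ [l _ [k _ <-]].
  by rewrite scale// (iterE f a)// fx !mulr0.
have [y gy] : exists y, g y != 0.
  apply: contrapT => /forallNP gn; apply: g0; apply/funext => v /=.
  by apply/eqP/negPn/negP/gn.
(* The constant is [c = |g x| / |f x|], and [w v <= 0] is the bound [|g v| <= c |f v|] with the
   denominator cleared. *)
pose w v : K^o := `|g v| * `|f x| - `|f v| * `|g x|.
have cw : continuous w.
  move=> v; apply: cvgB; apply: cvgM; try exact: cvg_cst.
    by apply: cvg_norm; exact: cg.
  by apply: cvg_norm; exact: cf.
(* [w + |w| = 0] encodes [w <= 0] as an equation, which extends from a dense
   set by continuity although the order of [K] is partial. *)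
have ww0 v : w v + `|w v| = 0.
  apply: (dense_continuous_eq0 _ _ _ (fun v => w v + `|w v| : K^o) dx).
    by move=> {}v; apply: cvgD; [|apply: cvg_norm]; exact: cw.
  (* At [l T^k x] the value of [w] is [|l| |f x| |g x| (|b|^k - |a|^k)]. *)
  move=> _ [l _ [k _ <-]].
  rewrite ler0_norm ?subrr// subr_le0 !scale// (iterE f a)// (iterE g b)//.
  rewrite !normrM !normrX -!mulrA [X in _ * (_ * X)]mulrC.
  apply: ler_wpM2l => //; apply: ler_wpM2r; first by rewrite mulr_ge0.
  exact: lerXn2r.
pose u := (- a) *: y + T y.
have fu : f u = 0 by rewrite /u lf fT -[_ *: _]/(- a * f y) mulNr addNr.
have gu : g u != 0.
  rewrite /u lg gT -[_ *: _]/(- a * g y) -mulrDl mulf_neq0// addrC subr_eq0.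
  by rewrite eq_sym.
have := ww0 u; rewrite /w fu normr0 mul0r subr0 normrM !normr_id -mulr2n => /eqP.
by rewrite mulrn_eq0 /= mulf_eq0 !normr_eq0 (negPf gu) (negPf fx).
Qed.

(** By Pascal's rule the sum telescopes. *)
Lemma alternating_bin_sum (A : pzRingType) (n j : nat) :
  \sum_(i < j.+1) (-1) ^+ i * 'C(n.+1, i)%:R = (-1) ^+ j * 'C(n, j)%:R :> A.
Proof.
elim: j => [|j IH]; first by rewrite big_ord_recl big_ord0 !bin0 addr0.
rewrite big_ord_recr /= IH binS natrD exprS mulN1r !mulNr mulrDr opprD.
by rewrite addrC -addrA addNr addr0.
Qed.

(** The powers of [t] combine to [t^(n-k)], whatever [i] is, and [C(n,i)/(n-i+1) = C(n+1,i)/(n+1)]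
    absorbs the Cesàro weight. The coefficient of [x k] is thus a truncated alternating sum of
    binomials, which [alternating_bin_sum] evaluates. *)
Lemma zfun_gen_cesaro (R : realType) (t : R) (n : nat) (x : omega R) :
  zfun t n (gen_cesaro t x) = n.+1%:R^-1 * zfun t n x.
Proof.
rewrite /zfun /gen_cesaro; move: (t%:C)%C => {}t.
pose F i k := n.+1%:R^-1 * ((-1) ^+ i * 'C(n.+1, i)%:R * t ^+ (n - k) * x k).
(* The inner range depends on [i]; it is turned into a condition on a fixed range so that the sums
   can be exchanged. *)
transitivity (\sum_(i < n.+1) \sum_(k < n.+1 | (k < (n - i).+1)%N) F i k).
  apply: eq_bigr => i _; have le_in : (i <= n)%N by rewrite -ltnS.
  rewrite -(big_ord_widen n.+1 (fun k => F i k)) ?ltnS ?leq_subr//.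
  rewrite mulr_suml mulr_sumr; apply: eq_bigr => k _; rewrite /F.
  have -> : 'C(n.+1, i)%:R = n.+1%:R / (n - i).+1%:R * 'C(n, i)%:R :> R[i]%C.
    apply: (mulfI (x := (n - i).+1%:R)); first by rewrite pnatr_eq0.
    rewrite mulrA mulrCA mulfV ?pnatr_eq0// mulr1 -!natrM.
    by rewrite -subSn// -mul_bin_down.
  have -> : (n - k = i + (n - i - k))%N.
    by rewrite addnC addnBAC ?subnK// -ltnS.
  by rewrite exprD; field; rewrite !nat1r !pnatr_eq0.
(* With [k = n - j] the condition [k <= n - i] becomes [i <= j]. *)
rewrite (exchange_big_dep predT)//= (reindex_inj rev_ord_inj) mulr_sumr /=.
apply: eq_bigr => j _; have le_jn : (j <= n)%N by rewrite -ltnS.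
rewrite subSS (eq_bigl (fun i : 'I_n.+1 => (i < j.+1)%N)); last first.
  by move=> i; rewrite !ltnS leq_sub2lE// -ltnS.
rewrite -(big_ord_widen n.+1 (fun i => F i (n - j)%N))//.
by rewrite -mulr_sumr -!mulr_suml alternating_bin_sum subKn.
Qed.

Lemma top_dual_zfun (R : realType) (S : pred (omega R)) (X : bkSpaceType S)
    (t : R) (n : nat) :
  top_dual X (fun x => zfun t n (val x)).
Proof.
split=> [c x y|x].
  have valE k : val (c *: x + y) k = c * val x k + val y k by rewrite linearP.
  rewrite -[c *: zfun _ _ _]/(c * zfun _ _ _) /zfun mulr_sumr -big_split.
  by apply: eq_bigr => i _; rewrite valE mulrDr mulrCA.
(* This is where the continuity of the inclusion of a BK-space enters. *)
have cx k : continuous (fun y : X => (val y : nat -> R[i]%C^o) k).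
  move=> y.
  apply: (@continuous_comp _ _ _ (val : X -> omega R) (fun z : omega R => z k)).
    exact: val_continuous.
  exact: (@proj_continuous nat (fun=> R[i]%C^o) k).
apply: cvg_big => [u|i _]; first exact: add_continuous.
by apply: cvgM; [exact: cvg_cst|exact: cx].
Qed.

(** The smaller index has the larger eigenvalue, so [z_t^[m]] is the functional that dominates. *)
Lemma zfun_not_supercyclic (R : realType) (S : pred (omega R))
    (X : bkSpaceType S) (t : R) (hC : exists_in S (gen_cesaro t)) (m n : nat) :
  (m < n)%N ->
  (fun x : X => zfun t m (val x)) <> cst 0 ->
  (fun x : X => zfun t n (val x)) <> cst 0 ->
  ~ supercyclic (restr_op X hC).
Proof.
move=> mn m0 n0.
have zT k x : zfun t k (val (restr_op X hC x)) = k.+1%:R^-1 * zfun t k (val x).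
  by rewrite /restr_op SubK zfun_gen_cesaro.
apply: (not_supercyclic_of_eigenfunctionals _ _ _ m.+1%:R^-1 n.+1%:R^-1 _ _
  (top_dual_zfun _ _ X t m) (top_dual_zfun _ _ X t n) m0 n0 (zT m) (zT n)).
  by rewrite (inj_eq invr_inj) eqr_nat eqSS neq_ltn mn.
rewrite !ger0_norm ?invr_ge0//.
by rewrite lef_pV2 ?posrE// ler_nat ltnS ltnW.
Qed.

Lemma zfun_neq0_of_c00 (R : realType) (S : pred (omega R)) (X : bkSpaceType S)
    (t : R) (n : nat) :
  c00 `<=` [set` S] -> (fun x : X => zfun t n (val x)) <> cst 0.
Proof.
(* On the [n]-th unit sequence only the term [i = 0] survives, and it equals 1. *)
pose e : omega R := fun k => (k == n)%:R; move=> c00S.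
have eS : e \in S.
  apply: c00S; apply: (sub_finite_set _ (finite_set1 n)) => k /=.
  by rewrite /e; case: (k =P n) => //; rewrite eqxx.
move/(congr1 (fun f => f (Sub e eS : X))); rewrite /= SubK => /eqP.
rewrite /zfun big_ord_recl big1 => [|i _].
  by rewrite expr0 bin0 expr0 subn0 /e eqxx !mulr1 addr0 oner_eq0.
by rewrite /e ltn_eqF ?mulr0// ltn_subLR ?lift0// addSn ltnS leq_addl.
Qed.

Theorem theorem3p11 (R : realType) (S : pred (omega R)) (X : bkSpaceType S)
    (t : R) (ht : 0 <= t <= 1)
    (hC : exists_in S (gen_cesaro t))
    (hz : (exists m n : nat,
             [/\ m <> n,
                 (top_dual X `\` [set cst 0]) (fun x : X => zfun t m (val x))
               & (top_dual X `\` [set cst 0]) (fun x : X => zfun t n (val x))])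
          \/ c00 `<=` [set` S]) :
  ~ supercyclic (restr_op X hC).
Proof.
case: hz => [[m [n [mn [_ m0] [_ n0]]]]|c00S]; last first.
  apply: (zfun_not_supercyclic _ _ X t hC 0 1) => //;
    exact: zfun_neq0_of_c00.
move/eqP: mn; rewrite neq_ltn => /orP[mn|nm].
  exact: (zfun_not_supercyclic _ _ X t hC m n).
exact: (zfun_not_supercyclic _ _ X t hC n m).
Qed.
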